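(* Let $\Theta=(\theta_1,\theta_2,\theta_3)^T\in\mathbb R^3$ (so $m=1$, $n=3$) with $1,\theta_1,\theta_2,\theta_3$ linearly independent over $\mathbb Z$. Then $\beta(\Theta)\geqslant\alpha(\Theta)\,g_1(\alpha(\Theta))$, where $$g_1(\alpha)=\frac{(1-\alpha)\alpha+\sqrt{(1-\alpha)^2\alpha^2+4\alpha(2\alpha^2-2\alpha+1)}}{4\alpha^2-4\alpha+2}.$$
   Context: $\|\cdot\|$ denotes distance to the nearest integer. For $\Theta=(\theta_1,\theta_2,\theta_3)^T$ define Jarník's function $\psi_\Theta(t)=\min_{x\in\mathbb Z,\,0<|x|\leqslant t}\max_{1\leqslant j\leqslant3}\|x\theta_j\|$ for $t\geqslant1$. $\alpha(\Theta)$ is the supremum of those $\gamma$ for which $\limsup_{t\to+\infty}t^\gamma\psi_\Theta(t)<+\infty$, and $\beta(\Theta)$ is the supremum of those $\gamma$ for which $\liminf_{t\to+\infty}t^\gamma\psi_\Theta(t)<+\infty$. *)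

(* Defs.v *)
From HB Require Import structures.
From mathcomp Require Import all_boot all_order all_algebra.
From mathcomp Require Import all_classical all_reals all_analysis.

Set Implicit Arguments.
Unset Strict Implicit.
Unset Printing Implicit Defensive.

Import Order.TTheory GRing.Theory Num.Theory.
Import numFieldNormedType.Exports.

Local Open Scope classical_set_scope.
Local Open Scope ring_scope.

Definition distZ (R : realType) (x : R) : R := inf [set `|x - n%:~R| | n in [set: int]].

Definition Zindep1 (R : realType) (Theta : 'cV[R]_3) : Prop :=
  forall (a : int) (b : 'I_3 -> int),
    a%:~R + \sum_(j < 3) (b j)%:~R * Theta j 0 = 0 ->
    a = 0 /\ forall j, b j = 0.

Definition simult_err (R : realType) (Theta : 'cV[R]_3) (x : int) : R :=
  \big[Num.max/0]_(j < 3) distZ (x%:~R * Theta j 0).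

Definition admissible (R : realType) (t : R) : set int :=
  [set x : int | 0 < `|x| /\ `|x|%:~R <= t].

(* For t >= 1 this [inf] is a minimum, see [jarnik_min] below; for t < 1 it is
   an unused default value. *)
Definition jarnik (R : realType) (Theta : 'cV[R]_3) (t : R) : R :=
  inf [set simult_err Theta x | x in admissible t].

(* The exponents live in [\bar R] because beta may be infinite. *)
Definition alpha (R : realType) (Theta : 'cV[R]_3) : \bar R :=
  ereal_sup [set gamma%:E | gamma in
    [set gamma : R |
      (limf_esup (fun t : R => (t `^ gamma * jarnik Theta t)%:E) (pinfty_nbhs R)
        < +oo)%E]].

Definition beta (R : realType) (Theta : 'cV[R]_3) : \bar R :=
  ereal_sup [set gamma%:E | gamma in
    [set gamma : R |
      (limf_einf (fun t : R => (t `^ gamma * jarnik Theta t)%:E) (pinfty_nbhs R)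
        < +oo)%E]].

Definition g1 (R : realType) (a : R) : R :=
  ((1 - a) * a + Num.sqrt ((1 - a) ^+ 2 * a ^+ 2
                           + 4 * a * (2 * a ^+ 2 - 2 * a + 1)))
  / (4 * a ^+ 2 - 4 * a + 2).

Lemma jarnik_min (R : realType) (Theta : 'cV[R]_3) (t : R) : 1 <= t ->
  (exists2 x, admissible t x & jarnik Theta t = simult_err Theta x) /\
  (forall x, admissible t x -> jarnik Theta t <= simult_err Theta x).
Proof.
move=> t1.
pose N := Num.truncn t.
pose s := [seq x <- [seq Posz i | i <- iota 0 N.+1] ++
                    [seq - Posz i | i <- iota 0 N.+1] | x != 0].
have sP x : admissible t x <-> x \in s.
  have -> : admissible t x = (x != 0 /\ `|x|%:~R <= t) by rewrite -normr_gt0.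
  rewrite mem_filter mem_cat.
  split=> [[-> ]|/andP[-> h]]; last first.
    split=> //; case/orP: h => /mapP[i]; rewrite mem_iota add0n ltnS => /andP[_ iN] ->;
      rewrite ?normrN /= -pmulrn; have := truncn_le t; rewrite (le_trans ler01 t1);
      by apply: le_trans; rewrite ler_nat.
  rewrite andTb => xt.
  have xN : (`|x|%N <= N)%N.
    rewrite /N -(@natrK R `|x|%N); apply: le_truncn.
    by move: xt; rewrite -abszE.
  apply/orP; case: (intP x) xN => [|n|n] xN; [left|left|right]; apply/mapP.
  - by exists 0%N.
  - by exists n.+1 => //; rewrite mem_iota add0n ltnS.
  - by exists n.+1 => //; rewrite mem_iota add0n ltnS; exact: xN.
have s0 : (1 : int) \in s by apply/sP; split => //; rewrite normr1.
have [y ys ymin] : exists2 y, y \in s &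
    forall x, x \in s -> simult_err Theta y <= simult_err Theta x.
  elim: s {sP} (1 : int) s0 => [//|a s IH] z zas.
  have [s_nil|] := eqVneq s [::].
    by exists a; rewrite ?mem_head// s_nil => x; rewrite inE => /eqP ->.
  case: s IH {zas} => // b s IH _.
  have [y ys ymin] := IH b (mem_head _ _).
  have [ay|ya] := leP (simult_err Theta a) (simult_err Theta y).
    exists a; rewrite ?mem_head// => x; rewrite inE => /orP[/eqP->//|xs].
    exact: le_trans ay (ymin _ xs).
  exists y; first by rewrite inE ys orbT.
  by move=> x; rewrite inE => /orP[/eqP->|/ymin//]; exact: ltW.
have lb : lbound [set simult_err Theta x | x in admissible t] (simult_err Theta y).
  by move=> _ [x /sP xs <-]; exact: ymin.
have jE : jarnik Theta t = simult_err Theta y.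
  apply/eqP; rewrite eq_le; apply/andP; split.
    apply: ge_inf; first by exists (simult_err Theta y).
    by exists y => //; apply/sP.
  apply: lb_le_inf => //; exists (simult_err Theta y), y => //; exact/sP.
by split=> [|x /sP xs]; [exists y => //; exact/sP|rewrite jE; exact: ymin].
Qed.

(* Main.v *)
Require Import Defs.
From mathcomp Require Import all_boot all_order all_algebra.
From mathcomp Require Import all_classical all_reals all_analysis.
From mathcomp Require Import perm ring lra.

(* The argument gives more than the theorem: with a = alpha, the exponent beta
   is at least a * g for every g > 1 with (1 - a) g^2 < a (g + 1), and g1 a is
   such a g as soon as it exceeds 1.

   Let z_0, z_1, ... in Z^4 be the best approximations, with first coordinates
   q_i and distances d_i.  Since they span Q^4, there are arbitrarily large
   m < k such that z_{m+1}, ..., z_{k+1} lie in the plane of z_k and z_{k+1},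
   while z_m, z_k, z_{k+1}, z_{k+2} are independent.  The determinant of these
   four vectors gives 1 << d_m d_k d_{k+1} q_{k+2}.  Both (z_{m+1}, z_{m+2}) and
   (z_k, z_{k+1}) are bases of the same planar lattice, whose area is comparable
   to q_{m+2} d_{m+1} and to q_{k+1} d_k.  If d_i << q_{i+1}^(-gamma) and
   q_{i+1} <= q_i^g for all large i, taking logarithms in these two relations
   yields (1 - gamma) g^2 >= gamma (g + 1).  Hence otherwise q_{i+1} > q_i^g
   infinitely often, and there d_i << q_i^(-gamma g). *)

Set Implicit Arguments.
Unset Strict Implicit.
Unset Printing Implicit Defensive.

Import Order.TTheory GRing.Theory Num.Theory.
Import numFieldNormedType.Exports.

Local Open Scope ring_scope.
Local Open Scope classical_set_scope.

(** * Linear algebra: spans of a sequence of vectors and a determinant bound *)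

Lemma rank_adds_row (F : fieldType) (m n : nat) (u : 'rV[F]_n) (A : 'M[F]_(m, n)) :
  ~~ (u <= A)%MS -> \rank (u + A)%MS = (\rank A).+1.
Proof.
move=> uA; apply/eqP; rewrite eqn_leq; apply/andP; split.
  apply: leq_trans (mxrank_adds_leqif u A) _.
  by rewrite -[(\rank A).+1]add1n leq_add2r rank_leq_row.
by apply: rank_ltmx; rewrite ltmxE addsmxSr /= addsmx_sub submx_refl andbT.
Qed.

(** A span [V k] of maximal rank contains every [y i], so each column of its cokernel matrix is
    annihilated by the whole sequence and vanishes. *)
Lemma spanning_initial_segment (F : fieldType) (n : nat) (y : nat -> 'rV[F]_n) :
  (forall v : 'cV[F]_n, (forall i, y i *m v = 0) -> v = 0) ->
  exists k, row_full (\sum_(i < k) <<y i>>)%MS.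
Proof.
move=> span; pose V k := (\sum_(i < k) <<y i>>)%MS.
have exr : exists s, `[< exists k, \rank (V k) = s >].
  by exists (\rank (V 0)); apply/asboolP; exists 0%N.
have bnd s : `[< exists k, \rank (V k) = s >] -> (s <= n)%N.
  by move/asboolP=> [k <-]; exact: rank_leq_col.
case: (ex_maxnP exr bnd) => s /asboolP[k rk] kmax.
have Vle l : (k <= l)%N -> (V k <= V l)%MS.
  move=> kl; apply/sumsmx_subP => i _.
  by rewrite (sumsmx_sup (widen_ord kl i)).
have yV i : (y i <= V k)%MS.
  have /eqmxP VE : (V k == V (maxn k i.+1))%MS.
    rewrite -(geq_leqif (mxrank_leqif_eq (Vle _ (leq_maxl _ _)))) rk.
    by apply: kmax; apply/asboolP; eexists.
  rewrite VE -genmxE.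
  by rewrite (sumsmx_sup (Ordinal (leq_maxr k i.+1))).
exists k; rewrite -sub1mx submxE mul1mx.
apply/eqP/matrixP => i j; have := span (col j (cokermx (V k))).
move=> /(_ _)/colP/(_ i); rewrite !mxE; apply => l.
by have := yV l; rewrite submxE colE mulmxA => /eqP ->; rewrite mul0mx.
Qed.

Lemma last_independent_quadruple (F : fieldType) (y : nat -> 'rV[F]_4) :
  (forall i, y i != 0) -> (forall i, ~~ (y i <= y i.+1)%MS) ->
  (forall v : 'cV[F]_4, (forall i, y i *m v = 0) -> v = 0) ->
  exists m k, [/\ (m.+1 < k)%N,
    (forall i, (m < i <= k)%N -> (y i <= y k.-1 + y k)%MS) &
    \det (\matrix_(i < 4) nth 0 [:: y m; y k.-1; y k; y k.+1] i) != 0].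
Proof.
move=> y0 yS span; pose V k := (\sum_(i < k) <<y i>>)%MS.
(* Take the shortest spanning initial segment: its last vector [y n] lies outside the span of the
   earlier ones, which therefore has rank 3. *)
have [[|n] Vn nmin] := ex_minnP (spanning_initial_segment span).
  by move: Vn; rewrite /row_full big_ord0 mxrank0.
have Vsub i k : (i < k)%N -> (y i <= V k)%MS.
  by move=> ik; rewrite -genmxE (sumsmx_sup (Ordinal ik)).
have VS k : (V k.+1 :=: y k + V k)%MS.
  apply/eqmxP; rewrite /V big_ord_recr /= !addsmx_sub addsmxSr genmxE addsmxSl.
  by rewrite addsmxSl -(genmxE (y k)) addsmxSr.
have yn : ~~ (y n <= V n)%MS.
  apply/negP => yV; suff : row_full (V n) by move/nmin; rewrite ltnn.
  rewrite -sub1mx (submx_trans (_ : (_ <= V n.+1)%MS)) ?sub1mx//.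
  by rewrite VS addsmx_sub yV submx_refl.
have rV : \rank (V n) = 3.
  have := rank_adds_row yn; rewrite -VS.
  by move/eqP: Vn => -> [].
case: n => [|[|k]] in Vn nmin yn rV *.
- by move: rV; rewrite /V big_ord0 mxrank0.
- have := rank_leq_row (y 0).
  by move: rV; rewrite /V VS /V big_ord0 addsmx0 => ->.
(* The index m is the last one before n whose vector leaves the plane of [y k] and [y k.+1]; it
   exists because [V k.+2] has rank 3. Maximality puts all later vectors before [y n] in that
   plane. *)
pose P i := (i < k.+2)%N && ~~ (y i <= y k + y k.+1)%MS.
have rP : \rank (y k + y k.+1)%MS = 2.
  by rewrite rank_adds_row// rank_rV y0.
have exP : exists i, P i.
  apply/not_existsP => nP; suff : (V k.+2 <= y k + y k.+1)%MS.
    by move/mxrankS; rewrite rP rV.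
  apply/sumsmx_subP => i _; rewrite genmxE; apply/negPn/negP => h.
  by apply: (nP i); rewrite /P ltn_ord.
have bP i : P i -> (i <= k.+2)%N by case/andP=> /ltnW.
have [m /andP[mk mP] mmax] := ex_maxnP exP bP.
exists m, k.+1; split.
- rewrite ltnNge ltnS; apply/negP => km; move: mP.
  move: mk; rewrite ltnS leq_eqVlt => /orP[/eqP->|]; first by rewrite addsmxSr.
  by rewrite ltnS => mk; rewrite (_ : m = k) ?addsmxSl//; apply/eqP; rewrite eqn_leq mk.
- move=> i /andP[mi ik]; apply/negPn/negP => h.
  by have := mmax i; rewrite /P ltnS ik h leqNgt mi => /(_ isT).
- rewrite -unitfE -unitmxE -row_full_unit -sub1mx.
  set A := \matrix_(i < 4) _.
  have Ai (i : 'I_4) : (nth 0 [:: y m; y k.+1.-1; y k.+1; y k.+2] i <= A)%MS.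
    pose r (i : 'I_4) := nth 0 [:: y m; y k.+1.-1; y k.+1; y k.+2] i.
    by rewrite -[X in (X <= _)%MS](rowK r) row_sub.
  have r4 : row_full (y k.+2 + (y m + (y k + y k.+1)))%MS.
    have yk : ~~ (y k.+2 <= y m + (y k + y k.+1))%MS.
      by apply: contra yn => /submx_trans; apply; rewrite !addsmx_sub !Vsub.
    by rewrite /row_full (rank_adds_row yk) (rank_adds_row mP) rP.
  move: r4; rewrite -sub1mx => /submx_trans; apply.
  have Am : (y m <= A)%MS := Ai 0; have Ak : (y k <= A)%MS := Ai 1.
  have Ak1 : (y k.+1 <= A)%MS := Ai 2; have Ak2 : (y k.+2 <= A)%MS := Ai 3.
  by rewrite !addsmx_sub Am Ak Ak1 Ak2.
Qed.

(** In the Leibniz expansion a permutation only reorders the factors [c], so all n! terms obey the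
    same bound. *)
Lemma normr_det_le (R : numDomainType) (n : nat) (A : 'M[R]_n) (r c : 'I_n -> R) :
  (forall i j, `|A i j| <= r i * c j) ->
  `|\det A| <= n`!%:R * (\prod_i r i * \prod_j c j).
Proof.
move=> Arc; apply: le_trans (ler_norm_sum _ _ _) _.
apply: (@le_trans _ _ (\sum_(s : 'S_n) \prod_i r i * \prod_j c j)).
  apply: ler_sum => s _; rewrite normrM normrX normrN1 expr1n mul1r normr_prod.
  rewrite [X in _ <= _ * X](reindex_inj (@perm_inj _ s)) -big_split /=.
  by apply: ler_prod => i _; rewrite normr_ge0 Arc.
by rewrite sumr_const card_Sn mulr_natl.
Qed.

(** * Integer vectors near the line through (1, Theta): distances and areas *)

Lemma nearest_int (R : realType) (x : R) : exists n : int, `|x - n%:~R| <= 2^-1.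
Proof.
exists (Num.floor (x + 2^-1)).
have := floor_le_tmp (x + 2^-1); have := lt_succ_floor (x + 2^-1).
by rewrite intrD ler_norml; set f := _%:~R => *; apply/andP; split; lra.
Qed.

(** A vector (q, p_1, p_2, p_3) encodes a signed denominator followed by three numerators. *)
Definition height (x : 'rV[int]_4) : int := x 0 0.

Definition dev (R : realType) (Theta : 'cV[R]_3) (x : 'rV[int]_4) (j : 'I_3) : R :=
  (x 0 (lift ord0 j))%:~R - (height x)%:~R * Theta j 0.

Definition dist (R : realType) (Theta : 'cV[R]_3) (x : 'rV[int]_4) : R :=
  \big[Num.max/0]_(j < 3) `|dev Theta x j|.

Definition minor (x y : 'rV[int]_4) (j : 'I_3) : int :=
  height x * y 0 (lift ord0 j) - height y * x 0 (lift ord0 j).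

(* Up to a constant factor, the area of the parallelogram spanned by [x] and [y]
   when both are close to the line through [(1, Theta)]. *)
Definition wedge (x y : 'rV[int]_4) : int := \big[Num.max/0]_(j < 3) `|minor x y j|.

Section Dist.
Variables (R : realType) (Theta : 'cV[R]_3).
Implicit Types x y w : 'rV[int]_4.

Lemma dev_le_dist x j : `|dev Theta x j| <= dist Theta x.
Proof. exact: (le_bigmax 0 (fun j => `|dev Theta x j|) j). Qed.

Lemma dist_ge0 x : 0 <= dist Theta x.
Proof. exact: le_trans (normr_ge0 _) (dev_le_dist x 0). Qed.

Lemma dist_attained x : exists j, dist Theta x = `|dev Theta x j|.
Proof.
have [//|//|j _ e] := @eq_bigmax _ _ _ 0 0 xpredT (fun j => `|dev Theta x j|).
by exists j.
Qed.

Lemma minor_le_wedge x y j : `|minor x y j| <= wedge x y.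
Proof. exact: (le_bigmax 0 (fun j => `|minor x y j|) j). Qed.

Lemma wedge_attained x y : exists j, wedge x y = `|minor x y j|.
Proof.
have [//|//|j _ e] := @eq_bigmax _ _ _ 0 0 xpredT (fun j => `|minor x y j|).
by exists j.
Qed.

Lemma distN x : dist Theta (- x) = dist Theta x.
Proof.
apply: eq_bigr => j _; rewrite -normrN /dev /height !mxE !intrN; congr `|_|; ring.
Qed.

(** Passing from numerators to deviations subtracts a multiple of the height column, which leaves
    the minor unchanged. *)
Lemma minorE x y j :
  (minor x y j)%:~R = (height x)%:~R * dev Theta y j - (height y)%:~R * dev Theta x j :> R.
Proof. by rewrite /minor intrD intrN !intrM /dev; ring. Qed.

Lemma wedge_le x y : 0 <= height x <= height y -> dist Theta y <= dist Theta x ->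
  (wedge x y)%:~R <= 2 * (height y)%:~R * dist Theta x.
Proof.
move=> /andP[x0 xy] yx; have [j ->] := wedge_attained x y.
rewrite intr_norm minorE.
have hx : 0 <= (height x)%:~R :> R by rewrite ler0z.
have hxy : (height x)%:~R <= (height y)%:~R :> R by rewrite ler_int.
apply: le_trans (ler_normB _ _) _; rewrite !normrM (ger0_norm hx) (ger0_norm (le_trans hx hxy)).
rewrite -mulrA mulr_natl mulr2n lerD//.
  by rewrite ler_pM//; exact: le_trans (dev_le_dist _ _) yx.
by rewrite ler_wpM2l ?dev_le_dist// (le_trans hx).
Qed.

Lemma wedge_ge x y : 0 <= height x -> 0 <= height y ->
  (height y)%:~R * dist Theta x - (height x)%:~R * dist Theta y <= (wedge x y)%:~R.
Proof.
move=> x0 y0; have [j ->] := dist_attained x.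
apply: (@le_trans _ _ (`|minor x y j|)%:~R); last by rewrite ler_int minor_le_wedge.
rewrite intr_norm minorE [X in _ <= X]distrC.
have hx : 0 <= (height x)%:~R :> R by rewrite ler0z.
have hy : 0 <= (height y)%:~R :> R by rewrite ler0z.
apply: le_trans (lerB_dist _ _); rewrite !normrM (ger0_norm hx) (ger0_norm hy).
by rewrite lerD2l lerN2 ler_wpM2l// dev_le_dist.
Qed.

Lemma wedgeC x y : wedge x y = wedge y x.
Proof. by apply: eq_bigr => j _; rewrite /minor distrC. Qed.

Lemma wedgeBr x y : wedge x (y - x) = wedge x y.
Proof. by apply: eq_bigr => j _; congr `|_|; rewrite /minor /height !mxE; ring. Qed.

(** Every minor is multiplied by the integer [a * d - b * c], which is nonzero because the new area
    is positive. *)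
Lemma wedge_comb_ge x y (a b c d : int) :
  0 < wedge (a *: x + b *: y) (c *: x + d *: y) ->
  wedge x y <= wedge (a *: x + b *: y) (c *: x + d *: y).
Proof.
set u := a *: _ + _; set v := c *: _ + _.
have E j : minor u v j = (a * d - b * c) * minor x y j.
  by rewrite /minor /height !mxE; ring.
have [i uvi] := wedge_attained u v; have [j ->] := wedge_attained x y.
rewrite uvi E normr_gt0 mulf_eq0 negb_or => /andP[abcd _].
rewrite -E -uvi; apply: le_trans (minor_le_wedge u v j).
by rewrite E normrM ler_peMl// -gtz0_ge1 normr_gt0.
Qed.

(** A vector of height zero has an integer distance, possibly 0, so the minimality clause leaves it
    out. The bound by 1 forces such a vector to vanish once it is nearer than some [z i]. *)
Definition best_seq (z : nat -> 'rV[int]_4) : Prop :=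
  [/\ forall i, 0 < height (z i) < height (z i.+1),
      forall i, 0 < dist Theta (z i.+1) < dist Theta (z i), dist Theta (z 0) < 1 &
      forall i w, height w != 0 -> `|height w| < height (z i.+1) ->
        dist Theta (z i) <= dist Theta w].

End Dist.

(* A unipotent column operation turns the columns of the matrix into the heights
   and the deviations. *)
Lemma det_dist_le (R : realType) (Theta : 'cV[R]_3) (x : 'I_4 -> 'rV[int]_4) (K : R) :
  (forall i, `|(height (x i))%:~R| <= dist Theta (x i) * K) ->
  `|(\det (\matrix_i x i))%:~R| <= 24 * ((\prod_i dist Theta (x i)) * K).
Proof.
move=> hK; pose X : 'M[R]_4 := map_mx intr (\matrix_i x i).
pose t : 'rV[R]_4 := \row_j oapp (fun k => Theta k 0) 0 (unlift 0 j).
pose T : 'M[R]_4 := 1%:M - delta_mx 0 0 *m t.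
have detT : \det T = 1.
  rewrite -det_tr det_trig; last first.
    apply/is_trig_mxP => i j ij; rewrite !mxE big_ord1 !mxE.
    have /negPf -> : j != i by rewrite neq_ltn ij orbT.
    have /negPf -> : j != 0 by rewrite -val_eqE /= -lt0n (leq_ltn_trans _ ij).
    by rewrite /= mul0r subr0.
  apply: big1 => i _; rewrite !mxE big_ord1 !mxE !eqxx.
  by have [->|] := eqVneq i 0; rewrite ?unlift_none ?mulr0 ?mul0r subr0.
have XT i j : (X *m T) i j = X i j - X i 0 * t 0 j.
  rewrite mulmxBr mulmx1 mulmxA -colE [LHS]mxE; congr (_ + _).
  by rewrite [LHS]mxE mxE big_ord1; congr (- (_ * _)); rewrite mxE.
rewrite -det_map_mx -/X.
have -> : \det X = \det (X *m T) by rewrite det_mulmx detT mulr1.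
(* The row factors are the distances; the column factor is [K] for the heights and 1 for the
   deviations. The constant 24 is 4!. *)
have XTle i j : `|(X *m T) i j| <= dist Theta (x i) * (if j == 0 then K else 1).
  rewrite XT !mxE; case: unliftP => [k ->|->] /=; last by rewrite mulr0 subr0 hK.
  by rewrite mulr1 dev_le_dist.
apply: le_trans (normr_det_le XTle) _.
rewrite [X in _ * (_ * X)](bigD1 0)//= [X in K * X]big1 ?mulr1//.
by move=> j /negPf ->.
Qed.

(** * Sequences of best approximations *)

Section BestSeq.
Variables (R : realType) (Theta : 'cV[R]_3) (z : nat -> 'rV[int]_4).
Hypothesis zbest : best_seq Theta z.

Lemma best_height_lt i : height (z i) < height (z i.+1).
Proof. by case: zbest => /(_ i)/andP[]. Qed.

Lemma best_height_le i j : (i <= j)%N -> height (z i) <= height (z j).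
Proof.
apply: (nondecreasing_seqP (fun n => height (z n))).1 => k.
exact: ltW (best_height_lt k).
Qed.

Lemma best_height_gt0 i : 0 < height (z i).
Proof. by case: zbest => /(_ i)/andP[]. Qed.

Lemma best_height_ge i : i%:Z <= height (z i).
Proof.
elim: i => [|i IH]; first exact: ltW (best_height_gt0 0).
by apply: le_lt_trans IH _ => //; exact: best_height_lt.
Qed.

Lemma best_dist_gt0 i : 0 < dist Theta (z i).
Proof. by case: zbest => _ /(_ i)/andP[h1 h2] _ _; exact: lt_trans h2. Qed.

Lemma best_dist_lt i : dist Theta (z i.+1) < dist Theta (z i).
Proof. by case: zbest => _ /(_ i)/andP[]. Qed.

Lemma best_dist_le i j : (i <= j)%N -> dist Theta (z j) <= dist Theta (z i).
Proof.
apply: (nonincreasing_seqP (fun n => dist Theta (z n))).1 => k.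
exact: ltW (best_dist_lt k).
Qed.

Lemma best_dist_lt1 i : dist Theta (z i) < 1.
Proof. by apply: le_lt_trans (best_dist_le (leq0n i)) _; case: zbest. Qed.

(* The difference of [z (i + 1)] and [z i] is a competitor of height less than
   that of [z (i + 1)], so it is at least as far from the line as [z i]; this
   covers the case where the two heights are close. *)
Lemma best_wedge_ge i :
  (height (z i.+1))%:~R * dist Theta (z i) <= 3 * (wedge (z i) (z i.+1))%:~R.
Proof.
have hx := ltW (best_height_gt0 i); have hy := ltW (best_height_gt0 i.+1).
have hxy := best_height_lt i.
have hw : 0 <= height (z i.+1 - z i) by rewrite /height !mxE subr_ge0 ltW.
have := wedge_ge Theta hx hy; have := wedge_ge Theta hw hx.
rewrite wedgeC wedgeBr.
have : dist Theta (z i) <= dist Theta (z i.+1 - z i).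
  case: zbest => _ _ _; apply; first by rewrite /height !mxE subr_eq0 gt_eqF.
  rewrite ger0_norm// /height !mxE gtrBl; exact: best_height_gt0.
have -> : (height (z i.+1 - z i))%:~R =
    (height (z i.+1))%:~R - (height (z i))%:~R :> R.
  by rewrite /height !mxE intrD intrN.
have := best_dist_lt i; have hx' : 0 <= (height (z i))%:~R :> R by rewrite ler0z.
have : 0 <= (height (z i.+1))%:~R :> R by rewrite ler0z.
set X := _%:~R in hx' *; set Y := (height (z i.+1))%:~R.
(* With d the distance of [z i] and W the area, the bounds give (Y - X) d <= W and (2X - Y) d <= W;
   twice the first plus the second is Y d <= 3W. *)
move: (dist _ _) (dist _ _) (dist _ _) => a b c; nra.
Qed.

Lemma best_wedge_gt0 i : 0 < wedge (z i) (z i.+1).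
Proof.
have := best_wedge_ge i; rewrite -(ltr0z R) => h.
rewrite -(pmulr_rgt0 (x := 3))//; apply: lt_le_trans h.
by rewrite mulr_gt0 ?ltr0z ?best_height_gt0 ?best_dist_gt0.
Qed.

(* Rounding the coefficients leaves an integer vector lower than [z (i + 1)] and
   closer to the line than [z i], which must vanish. *)
Lemma best_basis i (w : 'rV[int]_4) (a b : R) :
  (forall j, (w 0 j)%:~R = a * (z i 0 j)%:~R + b * (z i.+1 0 j)%:~R) ->
  exists c d : int, w = c *: z i + d *: z i.+1.
Proof.
move=> wE; have [c ac] := nearest_int a; have [d bd] := nearest_int b.
exists c, d; pose u := w - (c *: z i + d *: z i.+1).
have uE j : (u 0 j)%:~R =
    (a - c%:~R) * (z i 0 j)%:~R + (b - d%:~R) * (z i.+1 0 j)%:~R.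
  by rewrite !mxE intrD intrN intrD !intrM wE; ring.
have devu : dist Theta u < dist Theta (z i).
  have [j ->] := dist_attained Theta u.
  have -> : dev Theta u j =
      (a - c%:~R) * dev Theta (z i) j + (b - d%:~R) * dev Theta (z i.+1) j.
    by rewrite /dev /height !uE; ring.
  apply: le_lt_trans (ler_normD _ _) _; rewrite !normrM.
  have := dev_le_dist Theta (z i) j; have := dev_le_dist Theta (z i.+1) j.
  have := best_dist_lt i.
  have := normr_ge0 (dev Theta (z i) j); have := normr_ge0 (dev Theta (z i.+1) j).
  move: ac bd.
  move: (dist _ _) (dist _ _) `|dev _ _ _| `|dev _ _ _| `|_ - _| `|_ - _|.
  by move=> e e' ? ? ? ?; nra.
have hu : height u = 0.
  apply/eqP/negPn/negP => hu0.
  have : dist Theta (z i) <= dist Theta u.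
    case: zbest => _ _ _; apply => //.
    rewrite -(ltr_int R) intr_norm uE.
    apply: le_lt_trans (ler_normD _ _) _; rewrite !normrM.
    have := best_height_gt0 i; have := best_height_lt i.
    rewrite -(ltr_int R) -(ltr0z R) => h1 h2.
    rewrite [`|(z i 0 0)%:~R|]ger0_norm ?[`|(z i.+1 0 0)%:~R|]ger0_norm
      ?(ltW h2) ?(ltW (lt_trans h2 h1))//.
    move: h1 h2 ac bd; rewrite /height.
    move: (_%:~R) (_%:~R) `|_ - _| `|_ - _| => X Y p q; nra.
  by rewrite leNgt devu.
(* At height zero the deviations of [u] are its integer coordinates, all below 1 in absolute
   value. *)
have u0 : u = 0.
  apply/rowP => j; rewrite [RHS]mxE; case: (unliftP 0 j) => [k ->|->]; last exact: hu.
  have := dev_le_dist Theta u k; rewrite /dev hu mul0r subr0 => h.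
  have := le_lt_trans h (lt_trans devu (best_dist_lt1 i)).
  by rewrite -intr_norm (ltr_int R _ 1) ltNge -gtz0_ge1 normr_gt0 negbK => /eqP.
by apply/eqP; rewrite -subr_eq0 -/u u0.
Qed.

(** Clear denominators to get an integer form [u], and let [L] be its value at (1, Theta). As [u]
    vanishes on [z (N + i)], the height of that vector times [L] is a combination of deviations,
    hence bounded. The heights are unbounded, so [L] is 0 and independence kills [u]. *)
Lemma best_seq_span (N : nat) (v : 'cV[rat]_4) : Zindep1 Theta ->
  (forall i, map_mx intr (z (N + i)) *m v = 0) -> v = 0.
Proof.
move=> indep zv.
have [d d0 [u uE]] : exists2 d : int, d != 0 &
    exists u : 'I_4 -> int, forall j, d%:~R * v j 0 = (u j)%:~R.
  exists (\prod_j denq (v j 0)).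
    by apply/prodf_neq0 => j _; exact: denq_neq0.
  exists (fun j => numq (v j 0) * \prod_(l | l != j) denq (v l 0)) => j.
  rewrite (bigD1 j)//= !intrM mulrAC; congr (_ * _).
  by rewrite numqE mulrC.
have zu i : \sum_j z (N + i) 0 j * u j = 0.
  apply/eqP; rewrite -(intr_eq0 rat) rmorph_sum /=.
  have := zv i; move/matrixP/(_ 0 0); rewrite !mxE => h.
  apply/eqP; transitivity (d%:~R * \sum_j map_mx intr (z (N + i)) 0 j * v j 0);
    last by rewrite h mulr0.
  rewrite mulr_sumr; apply: eq_bigr => j _.
  by rewrite intrM -uE !mxE; ring.
pose L : R := (u 0)%:~R + \sum_(k < 3) (u (lift 0 k))%:~R * Theta k 0.
pose K : R := \sum_(k < 3) `|(u (lift 0 k))%:~R|.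
have hL i : (height (z (N + i)))%:~R * L =
    - \sum_(k < 3) (u (lift 0 k))%:~R * dev Theta (z (N + i)) k.
  apply/eqP; rewrite -addr_eq0; apply/eqP.
  transitivity ((\sum_j z (N + i) 0 j * u j)%:~R : R); last by rewrite zu.
  rewrite [X in _ = X%:~R]big_ord_recl intrD rmorph_sum /= -/(height _) intrM.
  rewrite /L mulrDr -addrA; congr (_ + _).
  rewrite mulr_sumr -big_split /=.
  by apply: eq_bigr => k _; rewrite intrM /dev; ring.
have L0 : L = 0.
  apply/eqP/negPn/negP => L0.
  have KL : 0 <= K / `|L| by rewrite divr_ge0// sumr_ge0.
  have := truncnS_gt (K / `|L|); set n := (Num.truncn _).+1.
  rewrite ltr_pdivrMr ?normr_gt0// ltNge => /negP; apply.
  have : `|(height (z (N + n)))%:~R * L| <= K.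
    rewrite hL normrN; apply: le_trans (ler_norm_sum _ _ _) _; apply: ler_sum => k _.
    rewrite normrM ler_piMr//; apply: le_trans (dev_le_dist _ _ _) _.
    exact: ltW (best_dist_lt1 _).
  apply: le_trans; rewrite normrM ler_wpM2r// ger0_norm; last first.
    by rewrite ler0z ltW// best_height_gt0.
  rewrite pmulrn ler_int (le_trans _ (best_height_ge _))// lez_nat leq_addl//.
have [u0 uk] := indep (u 0) (fun k => u (lift 0 k)) L0.
apply/colP => j; rewrite mxE; have := uE j.
have -> : u j = 0 by case: (unliftP 0 j) => [k ->|->].
by move/eqP; rewrite mulf_eq0 intr_eq0 (negPf d0) => /eqP.
Qed.

End BestSeq.

(** * Independent quadruples of best approximations and gaps between heights *)

Lemma best_quadruple (R : realType) (Theta : 'cV[R]_3) (z : nat -> 'rV[int]_4) (N : nat) :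
  Zindep1 Theta -> best_seq Theta z ->
  exists m k, [/\ (N <= m)%N, (m < k)%N,
    1 <= 24 * (dist Theta (z m) * dist Theta (z k) * dist Theta (z k.+1)
               * (height (z k.+2))%:~R) &
    (height (z k.+1))%:~R * dist Theta (z k) <=
    6 * ((height (z m.+2))%:~R * dist Theta (z m.+1))].
Proof.
move=> indep zb; pose y i : 'rV[rat]_4 := map_mx intr (z (N + i)%N).
have y0 i : y i != 0.
  apply/eqP => /rowP/(_ 0); rewrite !mxE => /eqP; rewrite intr_eq0.
  by rewrite gt_eqF// (best_height_gt0 zb).
have yS i : ~~ (y i <= y i.+1)%MS.
  apply/negP => /sub_rVP[a ya].
  have := best_wedge_gt0 zb (N + i); rewrite -addnS.
  have [j ->] := wedge_attained (z (N + i)) (z (N + i.+1)).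
  rewrite normr_gt0 -(intr_eq0 rat) /minor intrB !intrM.
  move/rowP: ya => ya; move: (ya 0) (ya (lift ord0 j)); rewrite !mxE /height => -> ->.
  by rewrite (_ : _ - _ = 0) ?eqxx//; ring.
have [m [[|k] [mk plane det0]]] :=
  last_independent_quadruple y0 yS (fun v => best_seq_span zb indep); first by [].
exists (N + m)%N, (N + k)%N; rewrite leq_addr ltn_add2l -ltnS mk; split=> //.
  pose x := [:: z (N + m); z (N + k); z (N + k).+1; z (N + k).+2].
  (* Heights increase and distances decrease, so the last vector has the largest ratio of height to
     distance. This choice cancels its distance from the product, leaving three distances and one
     height. *)
  pose K := (height (z (N + k).+2))%:~R / dist Theta (z (N + k).+2).
  have xK (i : 'I_4) : `|(height (nth 0 x i))%:~R| <= dist Theta (nth 0 x i) * K.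
    have [l lk ->] : exists2 l, (l <= (N + k).+2)%N & nth 0 x i = z l.
      case: i => [[|[|[|[|//]]]] ? /=].
      - by exists (N + m)%N => //; rewrite -!addnS leq_add2l (leq_trans (ltnW (ltnW mk))).
      - by exists (N + k)%N; rewrite // ltnW.
      - by exists (N + k).+1.
      - by exists (N + k).+2.
    rewrite ger0_norm ?ler0z ?(ltW (best_height_gt0 zb _))//.
    rewrite mulrA ler_pdivlMr ?(best_dist_gt0 zb)// mulrC ler_pM//.
    - exact: dist_ge0.
    - by rewrite ler0z (ltW (best_height_gt0 zb _)).
    - exact: (best_dist_le zb).
    - by rewrite ler_int (best_height_le zb).
  have := det_dist_le xK.
  rewrite 4!big_ord_recl big_ord0 /= /K mulr1.
  have -> (a b c d e : R) : a * (b * (c * d)) * (e / d) = a * b * c * e * (d / d) by ring.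
  rewrite divff ?gt_eqF ?(best_dist_gt0 zb)// mulr1; apply: le_trans.
  rewrite -intr_norm (ler_int R 1) -gtz0_ge1 normr_gt0 -(intr_eq0 rat) -det_map_mx.
  apply: contra det0 => /eqP <-; apply/eqP; congr (\det _).
  apply/matrixP => i j; rewrite !mxE.
  by case: i => [[|[|[|[|//]]]] ?]; rewrite /= !mxE ?addnS.
(* The rational coordinates in the plane are integers by [best_basis]. *)
have comb i : (m < i <= k.+1)%N ->
    exists c d : int, z (N + i)%N = c *: z (N + k)%N + d *: z (N + k).+1.
  move=> /plane/sub_addsmxP[[u v] /=]; rewrite [u]mx11_scalar [v]mx11_scalar !mul_scalar_mx.
  move: (u 0 0) (v 0 0) => a b /rowP yE.
  apply: (best_basis zb (a := ratr a) (b := ratr b)) => j.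
  have := yE j; rewrite !mxE addnS => /(congr1 (ratr : rat -> R)).
  by rewrite rmorphD !rmorphM /= !ratr_int.
have m1 : (m < m.+1 <= k.+1)%N by rewrite ltnSn ltnW.
have m2 : (m < m.+2 <= k.+1)%N by rewrite leqnSn.
have [c1 [d1 E1]] := comb _ m1; have [c2 [d2 E2]] := comb _ m2.
have W : wedge (z (N + k)%N) (z (N + k).+1) <= wedge (z (N + m).+1) (z (N + m).+2).
  rewrite !addnS in E1 E2; rewrite E1 E2; apply: wedge_comb_ge.
  by rewrite -E1 -E2 (best_wedge_gt0 zb).
(* The constant 6 is the 3 of [best_wedge_ge] times the 2 of [wedge_le]. *)
have := best_wedge_ge zb (N + k); have := @wedge_le _ Theta (z (N + m).+1) (z (N + m).+2).
rewrite (ltW (best_height_gt0 zb _)) (ltW (best_height_lt zb _)).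
move=> /(_ isT (ltW (best_dist_lt zb _))).
move: W; rewrite -(ler_int R) -mulrA; lra.
Qed.

(* [Q1], [Q2], [Q3], [Q4] are the logarithms of the heights of
   z_{m+1}, z_{m+2}, z_{k+1}, z_{k+2}, and [l1], [l2], [l3], [l4] those of the
   distances of z_m, z_{m+1}, z_k, z_{k+1}. *)
Lemma gap_exponent (R : realFieldType) (gamma g : R) :
  0 < gamma < 1 -> 1 < g -> (1 - gamma) * g ^+ 2 < gamma * (g + 1) ->
  exists2 e, 0 < e &
  forall c Q1 Q2 Q3 Q4 l1 l2 l3 l4 : R, 0 <= Q1 -> Q2 <= Q3 -> 0 <= Q2 ->
    l1 <= c - gamma * Q1 -> l2 <= c - gamma * Q2 -> l4 <= c - gamma * Q4 ->
    0 <= c + (l1 + l3 + l4 + Q4) -> Q3 + l3 <= c + (Q2 + l2) ->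
    Q2 <= g * Q1 -> Q4 <= g * Q3 -> e * Q3 <= 5 * c.
Proof.
move=> /andP[g0 g1'] g1 gg.
have gp : 0 < g by lra.
(* Eliminating the other variables gives (1 - (1 - gamma) g) Q3 <= 5c + t Q2. If t >= 0, bound t Q2
   by t Q3; the resulting coefficient times g is the slack in the assumed inequality. If t < 0, drop
   t Q2; then (1 - gamma) g < gamma < 1. *)
pose t := 1 - gamma - gamma / g.
have tE : g * t = (1 - gamma) * g - gamma by rewrite /t; field; rewrite gt_eqF.
case: (leP 0 t) => t0.
  exists (gamma + gamma / g - (1 - gamma) * g).
    rewrite -(pmulr_rgt0 _ gp).
    have -> : g * (gamma + gamma / g - (1 - gamma) * g) = gamma * (g + 1) - (1 - gamma) * g ^+ 2.
      by field; rewrite gt_eqF.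
    lra.
  move=> c Q1 Q2 Q3 Q4 l1 l2 l3 l4 Q10 Q23 Q20 h1 h2 h4 hd hp hg1 hg2.
  have : gamma / g * Q2 <= gamma * Q1 by rewrite mulrAC ler_pdivrMr// -mulrA ler_pM2l// mulrC.
  have : (1 - gamma) * Q4 <= (1 - gamma) * (g * Q3) by rewrite ler_pM2l// subr_gt0.
  have : t * Q2 <= t * Q3 by exact: ler_wpM2l.
  rewrite /t; set s := gamma / g; lra.
exists (1 - (1 - gamma) * g); first by move: tE t0; nra.
move=> c Q1 Q2 Q3 Q4 l1 l2 l3 l4 Q10 Q23 Q20 h1 h2 h4 hd hp hg1 hg2.
have : gamma / g * Q2 <= gamma * Q1 by rewrite mulrAC ler_pdivrMr// -mulrA ler_pM2l// mulrC.
have : (1 - gamma) * Q4 <= (1 - gamma) * (g * Q3) by rewrite ler_pM2l// subr_gt0.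
have : t * Q2 <= 0 by rewrite mulr_le0_ge0// ltW.
rewrite /t; set s := gamma / g; lra.
Qed.

(** Otherwise [gap_exponent], applied to quadruples arbitrarily far out, would bound the heights. *)
Lemma gap_infinitely_often (R : realType) (Theta : 'cV[R]_3) (z : nat -> 'rV[int]_4)
    (gamma g C : R) (N0 : nat) :
  Zindep1 Theta -> best_seq Theta z ->
  0 < gamma < 1 -> 1 < g -> (1 - gamma) * g ^+ 2 < gamma * (g + 1) ->
  (forall i, (N0 <= i)%N ->
    ln (dist Theta (z i)) <= C - gamma * ln (height (z i.+1))%:~R) ->
  forall N, exists2 i, (N <= i)%N &
    g * ln (height (z i))%:~R <= ln (height (z i.+1))%:~R :> R.
Proof.
move=> indep zb g01 g1 gg hC N; apply: contrapT => noi.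
have big i : (N <= i)%N -> ln (height (z i.+1))%:~R <= g * ln (height (z i))%:~R :> R.
  by move=> Ni; rewrite leNgt; apply/negP => /ltW h; apply: noi; exists i.
have [e e0 he] := gap_exponent g01 g1 gg.
(* One constant absorbs [C], the determinant factor 24 and the area factor 6. *)
pose c := Num.max C (ln 24).
(* Beyond index [P] the logarithm of the height exceeds 5c/e. *)
pose P := Num.truncn (expR (5 * c / e)).
have hp i : 0 < (height (z i))%:~R :> R by rewrite ltr0z (best_height_gt0 zb).
have hl i : 0 <= ln (height (z i))%:~R :> R.
  by rewrite ln_ge0// (ler_int R 1) -gtz0_ge1 (best_height_gt0 zb).
have dp i : 0 < dist Theta (z i) := best_dist_gt0 zb i.
have [m [k [Nm mk hdet hplane]]] := best_quadruple (maxn (maxn N N0) P.+1) indep zb.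
move: Nm; rewrite !geq_max => /andP[/andP[Nm N0m] Pm].
have hc i : (m <= i)%N -> ln (dist Theta (z i)) <= c - gamma * ln (height (z i.+1))%:~R.
  move=> mi; apply: le_trans (hC i (leq_trans N0m mi)) _.
  by rewrite lerD2r le_max lexx.
have : e * ln (height (z k.+1))%:~R <= 5 * c.
  apply: (he c (ln (height (z m.+1))%:~R) (ln (height (z m.+2))%:~R) _
    (ln (height (z k.+2))%:~R) (ln (dist Theta (z m))) (ln (dist Theta (z m.+1)))
    (ln (dist Theta (z k))) (ln (dist Theta (z k.+1)))) => //.
  - by rewrite ler_ln ?posrE// ler_int (best_height_le zb).
  - exact: hc.
  - exact: hc.
  - by apply: hc; rewrite ltnW// ltnW.
  - have := hdet; rewrite -ler_ln ?posrE ?mulr_gt0// ln1 !lnM ?posrE ?mulr_gt0//.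
    by move=> h; apply: le_trans h _; rewrite lerD2r le_max lexx orbT.
  - have := hplane; rewrite -ler_ln ?posrE ?mulr_gt0// !lnM ?posrE ?mulr_gt0//.
    move=> h; apply: le_trans h _; rewrite lerD2r le_max; apply/orP; right.
    by rewrite ler_ln ?posrE//; lra.
  - by apply: big; rewrite ltnW.
  - by apply: big; rewrite (leq_trans Nm)// ltnW// ltnW.
rewrite leNgt => /negP; apply.
rewrite [e * _]mulrC -ltr_pdivrMr// -ltr_expR lnK ?posrE//.
apply: lt_le_trans (truncnS_gt _) _; rewrite pmulrn ler_int.
apply: le_trans (best_height_ge zb _); rewrite lez_nat.
by rewrite (leq_trans Pm)// ltnW// ltnW.
Qed.

(** * Distance to the nearest integer and existence of best approximations *)

Lemma distZ_le (R : realType) (x : R) (n : int) : distZ x <= `|x - n%:~R|.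
Proof. by apply: ge_inf; [exists 0 => _ [m _ <-]|exists n]. Qed.

(** An integer other than the rounding [n] is at least 1 away from [n], hence at least 1/2 away from
    [x]. *)
Lemma distZ_attained (R : realType) (x : R) :
  exists2 n : int, distZ x = `|x - n%:~R| & `|x - n%:~R| <= 2^-1.
Proof.
have [n xn] := nearest_int x; exists n => //.
apply/le_anti; rewrite distZ_le lb_le_inf//; first by exists `|x - 0%:~R|, 0.
move=> _ [m _ <-]; have [->//|mn] := eqVneq m n.
have : 1 <= `|n%:~R - m%:~R| :> R.
  by rewrite -intrB -intr_norm (ler_int R 1) -gtz0_ge1 normr_gt0 subr_eq0 eq_sym.
have : `|n%:~R - m%:~R| <= `|x - n%:~R| + `|x - m%:~R| :> R.
  by rewrite [`|x - n%:~R|]distrC -(subrKA x) ler_normD.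
lra.
Qed.

Section SimultErr.
Variables (R : realType) (Theta : 'cV[R]_3).

Lemma simult_err_le_dist (w : 'rV[int]_4) : simult_err Theta (height w) <= dist Theta w.
Proof.
apply: le_bigmax2 => j _; rewrite /dev distrC; exact: distZ_le.
Qed.

Lemma simult_err_attained (x : int) :
  exists w : 'rV[int]_4, [/\ height w = x,
    dist Theta w = simult_err Theta x & dist Theta w <= 2^-1].
Proof.
have near (j : 'I_3) : exists n : int,
    distZ (x%:~R * Theta j 0) = `|x%:~R * Theta j 0 - n%:~R| /\
    `|x%:~R * Theta j 0 - n%:~R| <= 2^-1.
  by have [n] := distZ_attained (x%:~R * Theta j 0); exists n.
have [n nE] := choice near.
pose w : 'rV[int]_4 := \row_j oapp n x (unlift 0 j).
have hw : height w = x by rewrite /height mxE unlift_none.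
have devw j : `|dev Theta w j| = distZ (x%:~R * Theta j 0).
  by rewrite /dev hw mxE liftK /= distrC (nE j).1.
exists w; split=> //; first exact: eq_bigr.
by apply: bigmax_le => // j _; rewrite devw (nE j).1 (nE j).2.
Qed.

Lemma simult_errN (x : int) : simult_err Theta (- x) = simult_err Theta x.
Proof.
have le y : simult_err Theta (- y) <= simult_err Theta y.
  have [w [<- <- _]] := simult_err_attained y; rewrite -(distN Theta w).
  by have := simult_err_le_dist (- w); rewrite {1}/height mxE.
by apply/le_anti; rewrite le -{1}[x]opprK le.
Qed.

Lemma simult_err_norm (x : int) : simult_err Theta `|x| = simult_err Theta x.
Proof. by case: (ger0P x) => _; rewrite ?simult_errN. Qed.

Lemma dist_gt0 (w : 'rV[int]_4) : Zindep1 Theta -> height w != 0 -> 0 < dist Theta w.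
Proof.
move=> indep; apply: contraNT; rewrite -leNgt => dw.
have dev0 j : dev Theta w j = 0.
  by apply/eqP; rewrite -normr_le0 (le_trans (dev_le_dist _ _ _) dw).
(* A single vanishing deviation is already an integer relation between 1 and one coordinate of
   Theta. *)
pose b (j : 'I_3) := if j == 0 then height w else 0.
have lin0 : (- w 0 (lift ord0 0))%:~R + \sum_(j < 3) (b j)%:~R * Theta j 0 = 0.
  rewrite (bigD1 0)//= big1 => [|j /negPf j0]; last by rewrite /b j0 mul0r.
  by rewrite /b eqxx addr0 intrN addrC -[LHS]opprB -/(dev Theta w 0) dev0 oppr0.
by have [_ /(_ 0)] := indep _ _ lin0; rewrite /b eqxx => ->.
Qed.

(** The heights are built greedily from 1: the next one is the least positive integer with a
    strictly smaller error. It exists because independence keeps the current error positive. *)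
Lemma best_seq_exists : Zindep1 Theta ->
  (forall e, 0 < e -> exists2 x : int, x != 0 & simult_err Theta x < e) ->
  exists z, best_seq Theta z /\
    forall i, dist Theta (z i) = simult_err Theta (height (z i)).
Proof.
move=> indep small; pose E (q : nat) := simult_err Theta q%:Z.
have [v vP] := choice simult_err_attained.
have next q : exists q', (0 < q)%N ->
    [/\ (0 < q')%N, E q' < E q & forall r, (0 < r < q')%N -> E q <= E r].
  case: (ltnP 0 q) => q0; last by exists 0%N.
  have Eq0 : 0 < E q.
    by have [hq eq _] := vP q; rewrite /E -eq; apply: dist_gt0 => //; rewrite hq; case: (q) q0.
  have exr : exists r, (0 < r)%N && (E r < E q).
    have [x x0 xq] := small _ Eq0; exists `|x|%N.
    by rewrite absz_gt0 x0 /E abszE simult_err_norm.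
  have [r /andP[r0 rq] rmin] := ex_minnP exr.
  exists r => _; split=> // s /andP[s0 sr]; rewrite leNgt; apply/negP => sq.
  by have := rmin s; rewrite s0 sq leqNgt sr => /(_ isT).
have [f fP] := choice next.
pose q i := iter i f 1%N.
(* Since [q i] minimises the error up to itself, the next height, having a smaller error, must be
   larger. *)
have qP i : (0 < q i)%N /\ forall r, (0 < r <= q i)%N -> E (q i) <= E r.
  elim: i => [|i [q0 IH]].
    by split=> // r /andP[r0 r1]; rewrite (_ : r = 1%N)//; apply/eqP; rewrite eqn_leq r1.
  have [h1 h2 h3] := fP _ q0; split=> // r /andP[r0]; rewrite leq_eqVlt => /orP[/eqP->//|rq].
  by rewrite (le_trans (ltW h2))// h3// r0.
have qlt i : (q i < q i.+1)%N.
  have [q0 IH] := qP i; have [h1 h2 _] := fP _ q0.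
  by rewrite ltnNge; apply/negP => h; have := IH (q i.+1); rewrite h1 h leNgt h2 => /(_ isT).
exists (fun i => v (q i)); have hv x : height (v x) = x by have [] := vP x.
have dv x : dist Theta (v x) = simult_err Theta x by have [] := vP x.
split; last by move=> i; rewrite hv dv.
split.
- by move=> i; rewrite !hv !ltz_nat qlt (qP i).1.
- move=> i; rewrite dist_gt0//; last by rewrite hv; have := (qP i.+1).1; case: (q _).
  by rewrite !dv; have [_ + _] := fP _ (qP i).1.
- by have [_ _ h] := vP (q 0); apply: le_lt_trans h _; lra.
- move=> i w w0; rewrite hv dv -abszE ltz_nat => wq.
  have [_ _ h] := fP _ (qP i).1.
  apply: le_trans (simult_err_le_dist w); rewrite -(simult_err_norm (height w)) -abszE.
  by apply: (h `|height w|%N); rewrite absz_gt0 w0.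
Qed.

End SimultErr.

(** * The exponents and their expression through best approximations *)

Lemma limf_esup_lt_pinftyP (R : realType) (f : R -> R) :
  (limf_esup (fun t : R => (f t)%:E) (pinfty_nbhs R) < +oo)%E <->
  exists C M, forall t, M < t -> f t <= C.
Proof.
split=> [/ereal_inf_lt[_ [V [M [_ MV]] <-]]|[C [M fC]]].
  set s := ereal_sup _ => s_fin.
  have fs t : M < t -> ((f t)%:E <= s)%E.
    by move=> Mt; apply: ereal_sup_ubound; exists t => //; exact: MV.
  case: s s_fin fs => [r _ fs|//|_ fs]; first by exists r, M => t /fs; rewrite lee_fin.
  by have := fs (M + 1); rewrite ltrDl ltr01 => /(_ isT).
apply: (@le_lt_trans _ _ C%:E); last exact: ltry.
apply: ge_ereal_inf; exists (ereal_sup [set (f t)%:E | t in [set t | M < t]]).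
  by exists [set t | M < t] => //; exists M; split=> //; exact: num_real.
by apply: ge_ereal_sup => _ [t Mt <-]; rewrite lee_fin fC.
Qed.

Lemma limf_einf_lt_pinfty (R : realType) (f : R -> R) (C : R) :
  (forall M, exists2 t, M < t & f t <= C) ->
  (limf_einf (fun t : R => (f t)%:E) (pinfty_nbhs R) < +oo)%E.
Proof.
move=> fC; apply: (@le_lt_trans _ _ C%:E); last exact: ltry.
rewrite /limf_einf leeNl; apply: le_ereal_inf_tmp => _ [V [M [_ MV]] <-].
have [t Mt ft] := fC M; apply: (@le_trans _ _ (- f t)%:E); first by rewrite lee_fin lerN2.
by apply: ereal_sup_ubound; exists t => //; exact: MV.
Qed.

(** Membership in the set defining [alpha], by [alphaE]; a positive [C] allows taking [ln C]. *)
Definition uniform_exponent (R : realType) (Theta : 'cV[R]_3) (gamma : R) : Prop :=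
  exists C M, 0 < C /\ forall t, M < t -> t `^ gamma * jarnik Theta t <= C.

Definition ordinary_exponent (R : realType) (Theta : 'cV[R]_3) (gamma : R) : Prop :=
  exists C, forall M, exists2 t, M < t & t `^ gamma * jarnik Theta t <= C.

Section Exponents.
Variables (R : realType) (Theta : 'cV[R]_3).

Lemma uniform_exponent_ordinary gamma :
  uniform_exponent Theta gamma -> ordinary_exponent Theta gamma.
Proof.
move=> [C [M [_ hC]]]; exists C => M'; exists (Num.max M M' + 1).
  by rewrite ltr_pwDr// le_max lexx orbT.
by apply: hC; rewrite ltr_pwDr// le_max lexx.
Qed.

Lemma uniform_exponent0 : uniform_exponent Theta 0.
Proof.
exists 1, 1; split=> // t /ltW t1; rewrite powRr0 mul1r.
have [_ /(_ 1) jle] := jarnik_min Theta t1.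
apply: le_trans (jle _) _; first by split.
by have [w [_ <- h]] := simult_err_attained Theta 1; apply: le_trans h _; lra.
Qed.

(** This supplies the small errors that [best_seq_exists] asks for, in place of Dirichlet's theorem:
    [t] is taken with t^gamma > C/e. *)
Lemma uniform_exponent_small gamma : 0 < gamma -> uniform_exponent Theta gamma ->
  forall e, 0 < e -> exists2 x : int, x != 0 & simult_err Theta x < e.
Proof.
move=> g0 [C [M [C0 hC]]] e e0.
pose t := Num.max 1 (Num.max (M + 1) (expR (ln (C / e) / gamma) + 1)).
have t1 : 1 <= t by rewrite le_max lexx.
have Mt : M < t by rewrite !lt_max ltrDl ltr01 orbT.
have et : expR (ln (C / e) / gamma) < t by rewrite !lt_max ltrDl ltr01 !orbT.
have t0 : 0 < t by lra.
have [[x [x0 _] jE] _] := jarnik_min Theta t1.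
exists x; first by rewrite -normr_gt0.
rewrite -jE ltNge; apply/negP => ej.
have : t `^ gamma * e <= C by apply: le_trans (hC t Mt); rewrite ler_wpM2l// powR_ge0.
rewrite -ler_pdivlMr// -ler_ln ?posrE ?powR_gt0 ?divr_gt0// ln_powR mulrC.
rewrite -ler_pdivlMr// leNgt => /negP; apply.
by rewrite -ltr_expR lnK ?posrE.
Qed.

(** At t = q - 1, with q the height of [z i.+1], all admissible denominators are below q, so
    [jarnik] is at least the distance of [z i]. Replacing q - 1 by q/2 costs the term
    [gamma * ln 2]. *)
Lemma uniform_exponent_best gamma z : 0 <= gamma -> uniform_exponent Theta gamma ->
  best_seq Theta z -> exists C N, forall i, (N <= i)%N ->
    ln (dist Theta (z i)) <= C - gamma * ln (height (z i.+1))%:~R.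
Proof.
move=> g0 [C [M [C0 hC]]] zb.
exists (ln C + gamma * ln 2), (Num.truncn M).+2 => i Ni.
set q : R := (height (z i.+1))%:~R.
have iq : i.+1%:R <= q by rewrite pmulrn ler_int (best_height_ge zb).
have q2 : 2 <= q by apply: le_trans iq; rewrite ler_nat ltnS (leq_trans _ Ni).
have Mt : M < q - 1.
  apply: lt_le_trans (truncnS_gt M) _; rewrite lerBrDr natr1.
  by apply: le_trans iq; rewrite ler_nat ltnS ltnW.
have t1 : 1 <= q - 1 by lra.
have t0 : 0 < q - 1 by lra.
have [[x [x0 xt] jE] _] := jarnik_min Theta t1.
have dj : dist Theta (z i) <= jarnik Theta (q - 1).
  rewrite jE; have [w [wx <- _]] := simult_err_attained Theta x.
  case: zb => _ _ _; apply; first by rewrite wx -normr_gt0.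
  by rewrite wx -(ltr_int R) (le_lt_trans xt)// ltrBlDr ltrDl.
have : (q - 1) `^ gamma * dist Theta (z i) <= C.
  by apply: le_trans (hC _ Mt); rewrite ler_wpM2l// powR_ge0.
have d0 := best_dist_gt0 zb i.
rewrite -ler_ln ?posrE ?mulr_gt0 ?powR_gt0// lnM ?posrE ?powR_gt0// ln_powR.
have : gamma * ln (q / 2) <= gamma * ln (q - 1).
  by rewrite ler_wpM2l// ler_ln ?posrE//; lra.
rewrite ln_div ?posrE//; lra.
Qed.

(** Evaluate [jarnik] at the height of [z i], which is itself admissible there. *)
Lemma ordinary_exponent_best gamma C z : best_seq Theta z ->
  (forall i, dist Theta (z i) = simult_err Theta (height (z i))) ->
  (forall N, exists2 i, (N <= i)%N &
    ln (dist Theta (z i)) <= C - gamma * ln (height (z i))%:~R) ->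
  ordinary_exponent Theta gamma.
Proof.
move=> zb zE hz; exists (expR C) => M.
have [i Ni hi] := hz (Num.truncn M).+2.
set q : R := (height (z i))%:~R in hi *.
have iq : i%:R <= q by rewrite pmulrn ler_int (best_height_ge zb).
have q1 : 1 <= q by apply: le_trans iq; rewrite (ler_nat _ 1) (leq_trans _ Ni).
have q0 : 0 < q by lra.
exists q.
  by apply: lt_le_trans (truncnS_gt M) _; apply: le_trans iq; rewrite ler_nat ltnW.
have [_ /(_ (height (z i))) jle] := jarnik_min Theta q1.
have h0 := best_height_gt0 zb i.
apply: (@le_trans _ _ (q `^ gamma * dist Theta (z i))).
  rewrite ler_wpM2l ?powR_ge0// zE; apply: jle.
  by split; rewrite gtr0_norm.
have d0 := best_dist_gt0 zb i.
rewrite -[leLHS]lnK ?posrE ?mulr_gt0 ?powR_gt0// ler_expR.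
rewrite lnM ?posrE ?powR_gt0// ln_powR; lra.
Qed.

(** The area of two consecutive best approximations is a positive integer, so 1 <= 2 q_{i+1} d_i.
    For gamma > 1 this would bound the heights. *)
Lemma uniform_exponent_le1 gamma : Zindep1 Theta ->
  uniform_exponent Theta gamma -> gamma <= 1.
Proof.
move=> indep hg; rewrite leNgt; apply/negP => g1.
have g0 : 0 < gamma by lra.
have [z [zb _]] := best_seq_exists indep (uniform_exponent_small g0 hg).
have [C [N hz]] := uniform_exponent_best (ltW g0) hg zb.
pose i := maxn N (Num.truncn (expR ((ln 2 + C) / (gamma - 1)))).
have hi := hz i (leq_maxl _ _).
have hp j : 0 < (height (z j))%:~R :> R by rewrite ltr0z (best_height_gt0 zb).
have d0 := best_dist_gt0 zb i.
have : 1 <= 2 * (height (z i.+1))%:~R * dist Theta (z i).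
  apply: (@le_trans _ _ (wedge (z i) (z i.+1))%:~R).
    by rewrite (ler_int R 1) -gtz0_ge1 (best_wedge_gt0 zb).
  apply: wedge_le; last exact: ltW (best_dist_lt zb _).
  by rewrite (ltW (best_height_gt0 zb _)) (ltW (best_height_lt zb _)).
rewrite -ler_ln ?posrE ?mulr_gt0// ln1 !lnM ?posrE ?mulr_gt0// => h.
have : (gamma - 1) * ln (height (z i.+1))%:~R <= ln 2 + C by lra.
rewrite leNgt => /negP; apply.
rewrite -ltr_pdivrMl ?subr_gt0// mulrC -ltr_expR lnK ?posrE//.
apply: lt_le_trans (truncnS_gt _) _; rewrite pmulrn ler_int.
by apply: le_trans (best_height_ge zb _); rewrite lez_nat ltnS leq_maxr.
Qed.

Lemma uniform_ordinary_exponent gamma g : Zindep1 Theta ->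
  0 < gamma < 1 -> 1 < g -> (1 - gamma) * g ^+ 2 < gamma * (g + 1) ->
  uniform_exponent Theta gamma -> ordinary_exponent Theta (gamma * g).
Proof.
move=> indep g01 g1 gg hg; have /andP[g0 _] := g01.
have [z [zb zE]] := best_seq_exists indep (uniform_exponent_small g0 hg).
have [C [N hz]] := uniform_exponent_best (ltW g0) hg zb.
apply: (ordinary_exponent_best (C := C) zb zE) => M.
have [i] := gap_infinitely_often indep zb g01 g1 gg hz (maxn M N).
rewrite geq_max => /andP[Mi Ni] hi; exists i => //.
apply: le_trans (hz i Ni) _; rewrite lerD2l lerN2 -mulrA.
by rewrite ler_pM2l.
Qed.

Lemma alphaE : alpha Theta = ereal_sup [set gamma%:E | gamma in uniform_exponent Theta].
Proof.
congr ereal_sup; apply/seteqP; split=> _ [gamma h <-]; exists gamma => //=.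
  have /limf_esup_lt_pinftyP[C [M hC]] := h.
  exists (Num.max C 1), M; rewrite lt_max ltr01 orbT; split=> // t /hC h'.
  by rewrite le_max h'.
by apply/limf_esup_lt_pinftyP; have [C [M [_ hC]]] := h; exists C, M.
Qed.

Lemma ordinary_exponent_le_beta gamma : ordinary_exponent Theta gamma ->
  (gamma%:E <= beta Theta)%E.
Proof.
move=> [C hC]; apply: ereal_sup_ubound; exists gamma => //=.
exact: limf_einf_lt_pinfty hC.
Qed.

End Exponents.

(** * The function [g1] and the conclusion *)

Lemma g1_root (R : realType) (a : R) : 0 <= a <= 1 ->
  (2 * a ^+ 2 - 2 * a + 1) * g1 a ^+ 2 = (1 - a) * a * g1 a + a.
Proof.
move=> /andP[a0 a1].
have D0 : 0 < 2 * a ^+ 2 - 2 * a + 1 by nra.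
(* This is the discriminant of the quadratic; its leading coefficient is a^2 + (1 - a)^2 > 0. *)
set d := (1 - a) ^+ 2 * a ^+ 2 + 4 * a * (2 * a ^+ 2 - 2 * a + 1).
have d0 : 0 <= d by rewrite addr_ge0 // mulr_ge0 ?sqr_ge0 ?mulr_ge0 // ltW.
have := sqr_sqrtr d0; rewrite /g1 -/d; set s := Num.sqrt d => sE.
have -> : 4 * a ^+ 2 - 4 * a + 2 = 2 * (2 * a ^+ 2 - 2 * a + 1) by ring.
have Dn : 2 * a ^+ 2 - 2 * a + 1 != 0 by rewrite gt_eqF.
by rewrite expr_div_n sqrrD sE /d; field.
Qed.

(** By [g1_root], 1 - a times the difference of the two sides equals a^2 (g1^2 - 1). *)
Lemma g1_lt_optimal (R : realType) (a : R) : 0 <= a <= 1 -> 1 < g1 a ->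
  0 < a < 1 /\ (1 - a) * g1 a ^+ 2 < a * (g1 a + 1).
Proof.
move=> a01 g1a; have root := g1_root a01; case/andP: a01 => a0 a1.
(* At a = 0 and a = 1 the root equation reads g1^2 = 0 and g1^2 = 1, against g1 > 1. *)
have a0' : 0 < a.
  by rewrite lt_def a0 andbT; apply/eqP => ae; move: root g1a; rewrite ae; nra.
have a1' : a < 1.
  by rewrite lt_def a1 andbT; apply/eqP => ae; move: root g1a; rewrite -ae; nra.
rewrite a0' a1'; split=> //.
rewrite -(ltr_pM2l (x := 1 - a)) ?subr_gt0// -subr_gt0.
have -> : (1 - a) * (a * (g1 a + 1)) - (1 - a) * ((1 - a) * g1 a ^+ 2) =
    a ^+ 2 * (g1 a ^+ 2 - 1)
    + ((1 - a) * a * g1 a + a - (2 * a ^+ 2 - 2 * a + 1) * g1 a ^+ 2) by ring.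
by rewrite root subrr addr0 mulr_gt0 ?exprn_gt0// subr_gt0 exprn_egt1.
Qed.

Theorem theorem20 (R : realType) (Theta : 'cV[R]_3) (indep : Zindep1 Theta) :
  exists a : R, alpha Theta = a%:E /\ ((a * g1 a)%:E <= beta Theta)%E.
Proof.
have alpha0 : (0 <= alpha Theta)%E.
  rewrite alphaE; apply: ereal_sup_ubound; exists 0 => //; exact: uniform_exponent0.
have alpha1 : (alpha Theta <= 1)%E.
  rewrite alphaE; apply: ge_ereal_sup => _ [gamma hg <-].
  by rewrite lee_fin (uniform_exponent_le1 indep).
have alpha_fin : alpha Theta \is a fin_num.
  by rewrite fin_numElt (lt_le_trans (ltNyr 0) alpha0) (le_lt_trans alpha1 (ltry 1)).
exists (fine (alpha Theta)); rewrite fineK//; split=> //.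
set a := fine (alpha Theta); have aE : alpha Theta = a%:E by rewrite fineK.
have a0 : 0 <= a by rewrite -lee_fin -aE.
have a1 : a <= 1 by rewrite -lee_fin -aE.
have near_a x : x < a -> exists2 gamma, x < gamma <= a & uniform_exponent Theta gamma.
  rewrite -lte_fin -aE alphaE => /ereal_sup_gt[_ [gamma hg <-]]; rewrite lte_fin => xg.
  exists gamma => //; rewrite xg -lee_fin -aE alphaE.
  by apply: ereal_sup_ubound; exists gamma.
(* If g1 <= 1 the claim follows from alpha <= beta. *)
have [g1a|g1a] := leP (g1 a) 1.
  apply: (@le_trans _ _ (alpha Theta)).
    by rewrite aE lee_fin ler_piMr.
  rewrite alphaE; apply: ge_ereal_sup => _ [gamma hg <-].
  exact/ordinary_exponent_le_beta/uniform_exponent_ordinary.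
have [/andP[a0' a1'] ga] := g1_lt_optimal (introT andP (conj a0 a1)) g1a.
set g := g1 a in g1a ga *.
have g0 : 0 < g by lra.
rewrite leNgt; apply/negP => ba.
have beta0 : (0 <= beta Theta)%E.
  exact/ordinary_exponent_le_beta/uniform_exponent_ordinary/uniform_exponent0.
have beta_fin : beta Theta \is a fin_num.
  by rewrite fin_numElt (lt_le_trans (ltNyr 0) beta0) (lt_trans ba (ltry _)).
move: ba; rewrite -(fineK beta_fin) lte_fin -ltr_pdivrMr// => ba.
(* A gamma above the first bound has gamma g > beta; above the second it satisfies (1 - gamma) g^2 <
   gamma (g + 1). Both bounds lie below [a], the second because the inequality holds strictly at
   [a]. *)
pose x := Num.max (fine (beta Theta) / g) (g ^+ 2 / (g ^+ 2 + g + 1)).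
have gp : 0 < g ^+ 2 + g + 1 by rewrite !addr_gt0// exprn_gt0.
have xa : x < a.
  by rewrite gt_max ba ltr_pdivrMr//; lra.
have [gamma /andP[]] := near_a x xa.
rewrite gt_max => /andP[bg gg] ga' hg.
have gamma01 : 0 < gamma < 1.
  by rewrite (le_lt_trans ga' a1') andbT (le_lt_trans _ bg)// divr_ge0 ?fine_ge0// ltW.
have : ((gamma * g)%:E <= beta Theta)%E.
  apply/ordinary_exponent_le_beta/(uniform_ordinary_exponent indep gamma01 g1a) => //.
  by move: gg; rewrite ltr_pdivrMr//; lra.
by rewrite -(fineK beta_fin) lee_fin leNgt -ltr_pdivrMr// bg.
Qed.
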